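(* Let $M,N\in\mathbb N$ with $M>N$, let $\mathcal B\subseteq\mathcal D^N$, and let $x\in R^{p,0}_\omega$. On $\{-1,1\}^{\mathcal B}$ with the uniform probability, define $W(\theta)=\langle\sum_{K\in\mathcal B}\theta_Kh^M_K,x\rangle$. Then $\mathbb E(W)=0$ and $\mathrm{Var}(W)\le\|x\|_p^2\,|\bigcup\mathcal B|^{1/q}\,2^{-N/q}$, where $|\bigcup\mathcal B|$ is the Lebesgue measure of the union of the intervals in $\mathcal B$.
   Context: Fix $1<p<\infty$, $q=p/(p-1)$, $p^*=\max\{p,q\}$. All $L_r$ spaces are over $[0,1]$ with Lebesgue measure and $\langle g,f\rangle=\int_0^1gf$. A dyadic interval is $[(i-1)2^{-n},i2^{-n})$, $n\ge0$, $1\le i\le2^n$; $\mathcal D^n$ is the set of those of length $2^{-n}$ and $\mathcal D_n=\bigcup_{k=0}^n\mathcal D^k$. For a dyadic interval $I$, $I^+,I^-$ are its left and right halves and $h_I=\chi_{I^+}-\chi_{I^-}$. For each $n\in\mathbb N$ a family $(h^n_I)_{I\in\mathcal D_{n-1}}$ in $L_p$ is fixed with the same joint distribution as $(h_I)_{I\in\mathcal D_{n-1}}$, such that the $\sigma$-algebras $\sigma(h^n_I:I\in\mathcal D_{n-1})$, $n\in\mathbb N$, are independent. Let $\mathcal D_\omega=\{(n,I):n\in\mathbb N,I\in\mathcal D_{n-1}\}$, linearly ordered by $(m,J)\prec(n,I)$ iff $m<n$, or $m=n$ and $J$ precedes $I$ in $\mathcal D_{m-1}$ (intervals ordered first by level,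 coarser first, then from left to right). $R^{p,0}_\omega$ is the closed linear span of $\{h^n_I:(n,I)\in\mathcal D_\omega\}$ in $L_p$ (a distributional copy of the mean-zero hyperplane of the Bourgain–Rosenthal–Schechtman space $R^p_\omega$); $(h^n_I)_{(n,I)\in\mathcal D_\omega}$, in the order $\prec$, is an unconditional basis of it. *)

(* Defs.v *)
From HB Require Import structures.
From mathcomp Require Import all_boot all_order all_algebra.
From mathcomp Require Import all_classical all_reals all_analysis.
Set Implicit Arguments. Unset Strict Implicit. Unset Printing Implicit Defensive.
Import Order.TTheory GRing.Theory Num.Theory.
Local Open Scope classical_set_scope.
Local Open Scope ring_scope.

Section Defs.
Variable R : realType.

(* A dyadic interval is encoded as (k, i) with i < 2^k, denoting
   [i 2^-k, (i+1) 2^-k)  (0-based position i; the paper uses i+1). *)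
Definition dyad_ok (I : nat * nat) : Prop := (I.2 < 2 ^ I.1)%N.

Definition Dupto (n : nat) : set (nat * nat) :=
  [set I | (I.1 <= n)%N /\ dyad_ok I].

Definition dyad (I : nat * nat) : set R :=
  [set t | I.2%:R / 2 ^+ I.1 <= t /\ t < I.2.+1%:R / 2 ^+ I.1].

Definition haar (I : nat * nat) (t : R) : R :=
  let a := I.2%:R / 2 ^+ I.1 in
  let m := (I.2%:R + 2^-1) / 2 ^+ I.1 in
  let b := I.2.+1%:R / 2 ^+ I.1 in
  if (a <= t) && (t < m) then 1 else if (m <= t) && (t < b) then -1 else 0.

Definition leb := (@lebesgue_measure R).

Definition I01 : set R := `[0, 1].

Definition same_joint_distribution (h : nat -> nat * nat -> R -> R) (n : nat) : Prop :=
  forall B : nat * nat -> set R, (forall I, measurable (B I)) ->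
    leb (I01 `&` \bigcap_(I in Dupto n.-1) (h n I @^-1` B I))
    = leb (I01 `&` \bigcap_(I in Dupto n.-1) (haar I @^-1` B I)).

Definition gen_sigma (h : nat -> nat * nat -> R -> R) (n : nat) : set (set R) :=
  <<s I01, [set I01 `&` (h n I @^-1` B) | I in Dupto n.-1 & B in measurable] >>.

Definition independent_levels (h : nat -> nat * nat -> R -> R) : Prop :=
  forall (S : seq nat) (A : nat -> set R),
    uniq S -> all (fun n => (0 < n)%N) S ->
    (forall n, n \in S -> gen_sigma h n (A n)) ->
    leb (I01 `&` \bigcap_(n in [set` S]) A n) = (\prod_(n <- S) leb (A n))%E.

Definition BRS_family (h : nat -> nat * nat -> R -> R) : Prop :=
  [/\ (forall n I, (0 < n)%N -> Dupto n.-1 I -> measurable_fun I01 (h n I)),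
      (forall n, (0 < n)%N -> same_joint_distribution h n)
    & independent_levels h].

Definition Lpnorm (p : R) (f : R -> R) : \bar R :=
  poweR (\int[leb]_(t in I01) (powR `|f t| p)%:E) p^-1.

Definition lincomb (h : nat -> nat * nat -> R -> R)
  (s : seq ((nat * (nat * nat)) * R)) (t : R) : R :=
  \sum_(a <- s) a.2 * h a.1.1 a.1.2 t.

Definition valid_comb (s : seq ((nat * (nat * nat)) * R)) : Prop :=
  forall a, a \in s -> (0 < a.1.1)%N /\ Dupto a.1.1.-1 a.1.2.

Definition in_Rp0omega (p : R) (h : nat -> nat * nat -> R -> R) (x : R -> R) : Prop :=
  [/\ measurable_fun I01 x, (Lpnorm p x < +oo)%E &
      forall eps : R, 0 < eps -> exists s, valid_comb s /\
        (Lpnorm p (fun t => (x t - lincomb h s t)%R) < eps%:E)%E].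

Definition pairing (g f : R -> R) : R := Rintegral leb I01 (fun t => g t * f t).

Definition sgn (b : bool) : R := if b then 1 else -1.

Definition Eunif (T : finType) (F : T -> R) : R := #|T|%:R^-1 * \sum_(t : T) F t.
Definition Varunif (T : finType) (F : T -> R) : R := Eunif (fun t => (F t - Eunif F) ^+ 2).

End Defs.
Arguments leb {R}.
Arguments I01 {R}.
Arguments sgn {R}.

(* Main.v *)
(** With [c_K = <h^M_K, x>], orthogonality of the signs gives [E W = 0] and
    [Var W = sum_K c_K^2 <= (max_K |c_K|) (sum_K |c_K|)].  Almost everywhere exactly
    one of the [h^M_K], [K] in [D^N], is nonzero, and it is then [1] or [-1], so
    [||sum_K a_K h^M_K||_q^q = 2^-N sum_K |a_K|^q].  Hoelder's inequality bounds
    [|c_K|] by [||x||_p 2^(-N/q)] and, choosing the signs of the [c_K] as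
    coefficients, [sum_K |c_K|] by [||x||_p |U B|^(1/q)]. *)

Require Import Defs.
From HB Require Import structures.
From mathcomp Require Import all_boot all_order all_algebra.
From mathcomp Require Import all_classical all_reals all_analysis.
From mathcomp Require Import measurable_realfun ring lra.
Set Implicit Arguments.
Unset Strict Implicit.
Unset Printing Implicit Defensive.
Import Order.TTheory GRing.Theory Num.Theory.
Local Open Scope classical_set_scope.
Local Open Scope ring_scope.

(** * Orthogonality of independent uniform signs *)

Section UniformSigns.
Variables (R : realType) (T : finType).

Definition flip_at (K : T) (theta : {ffun T -> bool}) : {ffun T -> bool} :=
  [ffun L => (L == K) (+) theta L].

Lemma flip_atK (K : T) : involutive (flip_at K).
Proof. by move=> theta; apply/ffunP => L; rewrite !ffunE addKb. Qed.

Lemma sgn_flip_at (K L : T) (theta : {ffun T -> bool}) :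
  sgn (flip_at K theta L) = (if L == K then - sgn (theta L) else sgn (theta L)) :> R.
Proof. by rewrite ffunE; case: eqP => _; case: (theta L); rewrite /= ?opprK. Qed.

(** Flipping one sign is an involution of the sign vectors, so reindexing by it shows that the sum
    equals its own negative. *)
Lemma sum_flip_odd (K : T) (F : {ffun T -> bool} -> R) :
  (forall theta, F (flip_at K theta) = - F theta) -> \sum_theta F theta = 0.
Proof.
move=> FN; have : \sum_theta F theta = - \sum_theta F theta.
  rewrite -sumrN (reindex_inj (inv_inj (flip_atK K))).
  by apply: eq_bigr => theta _; rewrite FN.
lra.
Qed.

Lemma sum_sgn (K : T) : \sum_(theta : {ffun T -> bool}) sgn (theta K) = 0 :> R.
Proof. by apply: (sum_flip_odd (K := K)) => theta; rewrite sgn_flip_at eqxx. Qed.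

(** Off the diagonal, flipping the sign at [K] negates only one of the two factors; on the diagonal
    every product is [1]. *)
Lemma sum_sgnM (K L : T) :
  \sum_(theta : {ffun T -> bool}) sgn (theta K) * sgn (theta L)
  = (K == L)%:R * #|{ffun T -> bool}|%:R :> R.
Proof.
have [<-|KL] := eqVneq K L.
  rewrite mul1r -sumr_const; apply: eq_bigr => theta _.
  by case: (theta K); rewrite /sgn ?mulrNN mulr1.
rewrite mul0r; apply: (sum_flip_odd (K := K)) => theta.
by rewrite !sgn_flip_at eqxx eq_sym (negbTE KL) mulNr.
Qed.

Lemma card_signs_neq0 : #|{ffun T -> bool}|%:R != 0 :> R.
Proof. by rewrite pnatr_eq0 -lt0n; apply/card_gt0P; exists [ffun=> true]. Qed.

Lemma Eunif_rademacher (c : T -> R) :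
  Eunif (fun theta : {ffun T -> bool} => \sum_K sgn (theta K) * c K) = 0.
Proof.
rewrite /Eunif exchange_big big1 ?mulr0// => K _.
by rewrite -mulr_suml sum_sgn mul0r.
Qed.

Lemma Varunif_rademacher (c : T -> R) :
  Varunif (fun theta : {ffun T -> bool} => \sum_K sgn (theta K) * c K)
  = \sum_K c K ^+ 2.
Proof.
rewrite /Varunif Eunif_rademacher /Eunif.
under eq_bigr => theta _ do
  rewrite subr0 expr2 big_distrlr.
rewrite exchange_big mulr_sumr; apply: eq_bigr => K _.
rewrite exchange_big.
under eq_bigr => L _.
  rewrite (eq_bigr (fun theta : {ffun T -> bool} =>
    sgn (theta K) * sgn (theta L) * (c K * c L))); last first.
    by move=> theta _; exact: mulrACA.
  rewrite -mulr_suml sum_sgnM; over.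
(* Orthogonality leaves only [L = K], where the number of sign vectors cancels the normalising
   factor of [Eunif]. *)
rewrite (bigD1 K)//= big1 ?addr0 => [|L LK].
  by rewrite eqxx mul1r mulKf ?card_signs_neq0.
by rewrite eq_sym (negbTE LK) !mul0r.
Qed.

End UniformSigns.

(** * Hoelder's inequality on the unit interval and the duality pairing *)

Section Hoelder.
Import numFieldNormedType.Exports.
Variable R : realType.
Implicit Types f g : R -> R.

Lemma measurable_I01 : measurable (I01 : set R).
Proof. exact: measurable_itv. Qed.
#[local] Hint Resolve measurable_I01 : core.

(** Extension by zero carries the norm over [[0, 1]] to the whole line, where [hoelder] is stated;
    [0 < p] makes the [p]-th power vanish outside. *)
Lemma Lpnorm_restrict (p : R) f : 0 < p ->
  Lnorm (@leb R) p%:E (EFin \o (f \_ I01)) = Lpnorm p f.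
Proof.
move=> p0; rewrite unlock /Lpnorm; congr (poweR _ _).
rewrite [RHS]integral_mkcond; apply: eq_integral => t _ /=.
rewrite !patchE; case: ifPn => _; first by rewrite -poweR_EFin.
by rewrite normr0 powR0 ?gt_eqF.
Qed.

Lemma hoelder_I01 (p q : R) f g :
  measurable_fun I01 f -> measurable_fun I01 g -> 0 < p -> 0 < q ->
  p^-1 + q^-1 = 1 ->
  (\int[leb]_(t in I01) `|(f t * g t)%:E| <= Lpnorm p f * Lpnorm q g)%E.
Proof.
move=> mf mg p0 q0 pq.
have /measurable_restrictT mf' := mf; have /measurable_restrictT mg' := mg.
have := hoelder leb (mf' measurable_I01) (mg' measurable_I01) p0 q0 pq.
rewrite !Lpnorm_restrict// Lnorm1; apply: le_trans; rewrite le_eqVlt.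
apply/orP; left; apply/eqP; rewrite [LHS]integral_mkcond; apply: eq_integral => t _.
by rewrite /= !patchE; case: ifPn => _; rewrite ?mul0r ?normr0.
Qed.

Lemma integrable_pairing (p q : R) f g :
  measurable_fun I01 f -> measurable_fun I01 g -> 0 < p -> 0 < q ->
  p^-1 + q^-1 = 1 -> (Lpnorm p f < +oo)%E -> (Lpnorm q g < +oo)%E ->
  leb.-integrable I01 (EFin \o (fun t => f t * g t)).
Proof.
move=> mf mg p0 q0 pq fp gq; apply/integrableP; split.
  by apply/measurable_EFinP; exact: measurable_funM.
apply: (le_lt_trans (hoelder_I01 mf mg p0 q0 pq)).
by apply: lte_mul_pinfty; rewrite ?poweR_ge0// ge0_fin_numE ?poweR_ge0.
Qed.

Lemma pairing_le (p q : R) f g :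
  measurable_fun I01 f -> measurable_fun I01 g -> 0 < p -> 0 < q ->
  p^-1 + q^-1 = 1 -> (Lpnorm p f < +oo)%E -> (Lpnorm q g < +oo)%E ->
  `|pairing f g| <= fine (Lpnorm p f) * fine (Lpnorm q g).
Proof.
move=> mf mg p0 q0 pq fp gq.
have ifg := integrable_pairing mf mg p0 q0 pq fp gq.
have fpE : Lpnorm p f \is a fin_num by rewrite ge0_fin_numE ?poweR_ge0.
have gqE : Lpnorm q g \is a fin_num by rewrite ge0_fin_numE ?poweR_ge0.
rewrite -fineM// (le_trans (le_normr_Rintegral _ ifg))//.
apply: fine_le; [|by rewrite fin_numM|exact: hoelder_I01].
rewrite ge0_fin_numE; last by apply: integral_ge0 => t _; rewrite lee_fin.
by case/integrableP: ifg.
Qed.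

Lemma pairing_sum (I : finType) (a : I -> R) (f : I -> R -> R) g :
  (forall i, leb.-integrable I01 (EFin \o (fun t => f i t * g t))) ->
  pairing (fun t => \sum_i a i * f i t) g = \sum_i a i * pairing (f i) g.
Proof.
move=> ifg; rewrite /pairing /Rintegral.
have iafg i : leb.-integrable I01 (fun t => (a i * f i t * g t)%:E).
  under eq_fun do rewrite -mulrA EFinM.
  by apply: integrableZl; [exact: measurable_I01|exact: ifg].
under eq_integral => t _ do rewrite mulr_suml -sumEFin.
rewrite integral_sum//.
rewrite -sum_fine => [|i _]; last first.
  by apply: integrable_fin_num; [exact: measurable_I01|exact: iafg].
apply: eq_bigr => i _.
under eq_integral => t _ do rewrite -mulrA.
by apply: (RintegralZl _ _ (ifg i)); exact: measurable_I01.
Qed.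

End Hoelder.

(** * Dyadic intervals, their measures and the supports of Haar functions *)

Section Dyadic.
Variable R : realType.

Lemma dyadE (I : nat * nat) (t : R) :
  dyad I t <-> (I.2%:R <= t * 2 ^+ I.1) /\ (t * 2 ^+ I.1 < I.2%:R + 1).
Proof.
rewrite /dyad /= -[I.2.+1%:R]natr1.
by rewrite ler_pdivrMr ?exprn_gt0// ltr_pdivlMr ?exprn_gt0.
Qed.

(** Both indices are the integer part of [t * 2 ^+ N]. *)
Lemma dyad_inj (N i j : nat) (t : R) : dyad (N, i) t -> dyad (N, j) t -> i = j.
Proof.
move=> /dyadE[/= ti it] /dyadE[/= tj jt].
have le_ij : (i < j.+1)%N by rewrite -(ltr_nat R) -natr1; lra.
have le_ji : (j < i.+1)%N by rewrite -(ltr_nat R) -natr1; lra.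
by apply/eqP; rewrite eqn_leq -ltnS le_ij.
Qed.

Lemma haar_dyad (I : nat * nat) (t : R) : dyad I t -> haar I t = 1 \/ haar I t = -1.
Proof.
move=> [at_ tb]; rewrite /haar at_ tb /=.
by case: ltP => _; [left|right].
Qed.

Lemma haar_notin_dyad (I : nat * nat) (t : R) : ~ dyad I t -> haar I t = 0.
Proof.
move=> tI; rewrite /haar; case: ifPn => [/andP[at_ tm]|_].
  case: tI; split => //; apply: lt_trans tm _.
  by rewrite ltr_pM2r ?invr_gt0 ?exprn_gt0// -[I.2.+1%:R]natr1; lra.
case: ifPn => // /andP[mt tb]; case: tI; split => //; apply: le_trans mt.
by rewrite ler_pM2r ?invr_gt0 ?exprn_gt0//; lra.
Qed.

Lemma dyad_itv (I : nat * nat) :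
  dyad I = [set` `[I.2%:R / 2 ^+ I.1, I.2.+1%:R / 2 ^+ I.1[] :> set R.
Proof. by apply/seteqP; split => t; rewrite /= in_itv /= => /andP. Qed.

Lemma measurable_dyad (I : nat * nat) : measurable (dyad I : set R).
Proof. by rewrite dyad_itv. Qed.

Lemma leb_dyad (I : nat * nat) : leb (dyad I) = (2 ^- I.1)%:E :> \bar R.
Proof.
rewrite dyad_itv /leb lebesgue_measure_itv /= lte_fin.
rewrite ltr_pM2r ?invr_gt0 ?exprn_gt0// ltr_nat ltnSn -EFinD -[I.2.+1%:R]natr1.
by congr EFin; ring.
Qed.

Lemma dyad_sub_I01 (I : nat * nat) : dyad_ok I -> dyad I `<=` (I01 : set R).
Proof.
move=> okI t /dyadE[It tI]; rewrite /I01 /= in_itv /=.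
have c0 : 0 < 2 ^+ I.1 :> R by rewrite exprn_gt0.
(* The strict inequality [dyad_ok] between naturals gains a unit, which keeps the right endpoint at
   most [1]. *)
have It1 : I.2%:R + 1 <= 2 ^+ I.1 :> R by rewrite natr1 -natrX ler_nat.
rewrite -(ler_pM2r c0) mul0r (le_trans _ It) ?ler0n//=.
by rewrite -(ler_pM2r c0) mul1r; lra.
Qed.

Lemma leb_bigcup_dyad (N : nat) (B : {set 'I_(2 ^ N)}) :
  leb (\bigcup_(K in [set K : 'I_(2 ^ N) | K \in B]) dyad (N, nat_of_ord K))
  = (#|B|%:R * 2 ^- N)%:E :> \bar R.
Proof.
rewrite (bigcup_pred (mem B)) /leb measure_bigsetU_ord_cond.
- rewrite (eq_bigr (fun=> (2 ^- N)%:E)); last by move=> K _; rewrite [LHS]leb_dyad.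
  by rewrite sumEFin sumr_const mulr_natl.
- by move=> K _; exact: measurable_dyad.
- move=> K L _ _ [t [Kt Lt]]; apply: val_inj; exact: dyad_inj Kt Lt.
Qed.

End Dyadic.

(** * Atoms of one Haar level and norms of its linear combinations *)

Section HaarCopies.
Variable R : realType.

Lemma leb_I01 : leb (I01 : set R) = 1%:E.
Proof. by rewrite /leb /I01 lebesgue_measure_itv /= lte_fin ltr01 -EFinB subr0. Qed.

(* Prescribes that, among the level-[N] functions, only the [K]-th is nonzero. *)
Definition atom_target (N K : nat) (I : nat * nat) : set R :=
  if I.1 == N then if I.2 == K then [set 1] `|` [set -1] else [set 0] else setT.

(** The intersection runs over all of [Dupto n], with no constraint off level [N], to match the sets
    compared in [same_joint_distribution]. *)
Definition atom (f : nat * nat -> R -> R) (n N K : nat) : set R :=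
  I01 `&` \bigcap_(I in Dupto n) (f I @^-1` atom_target N K I).

Lemma measurable_atom_target (N K : nat) I : measurable (atom_target N K I).
Proof.
rewrite /atom_target; case: ifP => // _; case: ifP => _; last exact: measurable_set1.
by apply: measurableU; exact: measurable_set1.
Qed.

Lemma finite_Dupto n : finite_set (Dupto n).
Proof.
apply: (@sub_finite_set _ _ (`I_n.+1 `*` `I_(2 ^ n))); last first.
  by apply: finite_setX; exact: finite_II.
move=> [k i] [/= kn ki]; split => //=.
by apply: leq_trans ki _; rewrite leq_exp2l.
Qed.

Lemma measurable_atom (f : nat * nat -> R -> R) n N K :
  (forall I, Dupto n I -> measurable_fun I01 (f I)) -> measurable (atom f n N K).
Proof.
move=> mf; rewrite /atom.
(* Each [f I] is measurable only on [I01], so every preimage is first intersected with [I01]. *)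
have -> : I01 `&` \bigcap_(I in Dupto n) (f I @^-1` atom_target N K I) =
    I01 `&` \bigcap_(I in Dupto n) (I01 `&` (f I @^-1` atom_target N K I)).
  apply/seteqP; split => t [t01 ft]; split => // I nI; first by split => //; exact: ft.
  by case: (ft I nI).
apply: measurableI; first exact: measurable_I01.
apply: fin_bigcap_measurable (finite_Dupto n) _ => I nI.
by apply: mf => //; [exact: measurable_I01|exact: measurable_atom_target].
Qed.

Lemma atom_norm (f : nat * nat -> R -> R) n N K t :
  (N <= n)%N -> (K < 2 ^ N)%N -> atom f n N K t -> `|f (N, K) t| = 1.
Proof.
move=> Nn KN [_ /(_ (N, K))]; rewrite /atom_target /= !eqxx => /(_ (conj Nn KN)).
by case=> /= ->; rewrite ?normrN normr1.
Qed.

Lemma atom_eq0 (f : nat * nat -> R -> R) n N K L t :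
  (N <= n)%N -> (L < 2 ^ N)%N -> L != K -> atom f n N K t -> f (N, L) t = 0.
Proof.
move=> Nn LN LK [_ /(_ (N, L))].
by rewrite /atom_target /= eqxx (negbTE LK) => /(_ (conj Nn LN)).
Qed.

(** A Haar function is nonzero exactly on its dyadic interval, and the intervals of one level are
    disjoint. *)
Lemma atom_haar n N K : (N <= n)%N -> (K < 2 ^ N)%N ->
  atom (@haar R) n N K = dyad (N, K).
Proof.
move=> Nn KN; apply/seteqP; split => t; last first.
  move=> Kt; split; first exact: (@dyad_sub_I01 R (N, K) KN).
  move=> [k i] [/= kn ik]; rewrite /atom_target /=.
  have [kN|//] := eqVneq k N; subst k.
  have [iK|iK] := eqVneq i K; first by subst i; exact: haar_dyad.
  apply: haar_notin_dyad => it; move/eqP: iK; apply; exact: dyad_inj it Kt.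
move=> tK; have [//|/haar_notin_dyad h0] := pselect (dyad (N, K) t).
by have := atom_norm Nn KN tK; rewrite h0 normr0 => /eqP; rewrite eq_sym oner_eq0.
Qed.

(** At a common point of two distinct atoms, [f (N, K)] would have both modulus [1] and value
    [0]. *)
Lemma trivIset_atom (f : nat * nat -> R -> R) n N (D : set 'I_(2 ^ N)) :
  (N <= n)%N -> trivIset D (fun K : 'I_(2 ^ N) => atom f n N K).
Proof.
move=> Nn K L _ _ [t [Kt Lt]]; apply/eqP/negPn/negP => KL.
have := atom_norm Nn (ltn_ord K) Kt; rewrite (atom_eq0 Nn (ltn_ord K) KL Lt).
by rewrite normr0 => /eqP; rewrite eq_sym oner_eq0.
Qed.

Variables (h : nat -> nat * nat -> R -> R) (M N : nat).
Hypotheses (hh : BRS_family h) (NM : (N < M)%N).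

Let NM1 : (N <= M.-1)%N. Proof. by rewrite -ltnS prednK// (leq_ltn_trans _ NM). Qed.
Let M0 : (0 < M)%N. Proof. exact: leq_ltn_trans NM. Qed.
Let A (K : 'I_(2 ^ N)) : set R := atom (h M) M.-1 N K.

Lemma measurable_level (K : 'I_(2 ^ N)) : measurable_fun I01 (h M (N, nat_of_ord K)).
Proof. by case: hh => mh _ _; apply: mh => //; split => //=; exact: ltn_ord. Qed.

Let mA K : measurable (A K).
Proof. by apply: measurable_atom => I MI; case: hh => mh _ _; exact: mh. Qed.

(** Equality of joint distributions replaces the atom by that of the genuine Haar system, which is a
    dyadic interval. *)
Let lebA K : leb (A K) = (2 ^- N)%:E.
Proof.
case: hh => _ hd _; rewrite /A /atom hd//; last exact: measurable_atom_target.
by rewrite -/(atom _ _ _ _) atom_haar ?leb_dyad.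
Qed.

Let AI01 K : A K `<=` I01. Proof. by move=> t []. Qed.

Let G : set R := \big[setU/set0]_K A K.

Let mG : measurable G. Proof. by apply: bigsetU_measurable => K _; exact: mA. Qed.

Let GI01 : G `<=` I01.
Proof. by apply: (big_ind (fun S => S `<=` I01)) => // X Y XI YI t [/XI|/YI]. Qed.

(* The [2 ^ N] disjoint atoms of measure [2 ^- N] exhaust [[0, 1]]. *)
Let leb_off_atoms : leb (I01 `\` G) = 0%E.
Proof.
rewrite /leb measureD//; [|exact: measurable_I01|].
  have -> : I01 `&` G = G by apply/setIidPr.
  rewrite /G measure_bigsetU_ord//; last exact: trivIset_atom.
  rewrite (eq_bigr (fun=> (2 ^- N)%:E)); last by move=> K _; exact: lebA.
  rewrite sumEFin sumr_const card_ord [X in (X - _)%E]leb_I01.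
  by rewrite -[_ *+ (2 ^ N)]mulr_natl natrX divff ?subee// expf_neq0.
by rewrite [X in (X < _)%E]leb_I01 ltry.
Qed.

Lemma integral_powR_level (q : R) (a : 'I_(2 ^ N) -> R) :
  (\int[leb]_(t in I01)
     (`|\sum_K a K * h M (N, nat_of_ord K) t| `^ q)%:E
   = ((\sum_K `|a K| `^ q) * 2 ^- N)%:E)%E.
Proof.
set g := fun t => _.
have mg : measurable_fun I01 g.
  apply/measurable_EFinP.
  apply: (measurableT_comp (measurable_powR q)).
  apply: measurableT_comp => //; apply: measurable_sum => K.
  by apply: measurable_funM => //; exact: measurable_level.
have g0 t : (0 <= g t)%E by rewrite lee_fin powR_ge0.
(* By [leb_off_atoms] the integral may be taken over the union [G] of the atoms, then split atom by
   atom. *)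
rewrite (@ge0_negligible_integral _ _ _ leb I01 (I01 `\` G) g)//; first last.
- exact: measurable_I01.
- by apply: measurableD => //; exact: measurable_I01.
rewrite setDD (_ : I01 `&` G = G); last exact/setIidPr.
have mgG : measurable_fun G (g : R -> \bar R).
  by apply: measurable_funS mg; [exact: measurable_I01|exact: GI01].
rewrite ge0_integral_bigsetU//; [|exact: index_enum_uniq|exact: trivIset_atom].
rewrite mulr_suml -sumEFin; apply: eq_bigr => K _.
transitivity (\int[leb]_(t in A K) cst (`|a K| `^ q)%:E t)%E; last first.
  rewrite integral_cst; last exact: mA.
  by rewrite [X in (_ * X)%E = _]lebA -EFinM.
apply: eq_integral => t; rewrite inE => Kt.
(* On the atom [A K] only the [K]-th term survives, with modulus that of [a K]. *)
rewrite /g (bigD1 K)//= big1 ?addr0 => [|L LK]; last first.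
  by rewrite (atom_eq0 NM1 (ltn_ord L) LK Kt) mulr0.
by rewrite normrM (atom_norm NM1 (ltn_ord K) Kt) mulr1.
Qed.

Lemma Lpnorm_level (q : R) (a : 'I_(2 ^ N) -> R) :
  Lpnorm q (fun t => \sum_K a K * h M (N, nat_of_ord K) t)
  = (((\sum_K `|a K| `^ q) * 2 ^- N) `^ q^-1)%:E.
Proof. by rewrite /Lpnorm integral_powR_level poweR_EFin. Qed.

End HaarCopies.

(** * Mean and variance of the randomly signed pairing *)

Theorem mainTheorem6 (R : realType) (p : R) (hp : 1 < p)
  (h : nat -> nat * nat -> R -> R) (hh : BRS_family h)
  (M N : nat) (hMN : (N < M)%N) (B : {set 'I_(2 ^ N)})
  (x : R -> R) (hx : in_Rp0omega p h x) :
  let q := p / (p - 1) in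
  let W := fun theta : {ffun {K : 'I_(2 ^ N) | K \in B} -> bool} =>
    pairing (fun t => \sum_(K : {K : 'I_(2 ^ N) | K \in B})
                         sgn (theta K) * h M (N, nat_of_ord (val K)) t) x in
  Eunif W = 0 /\
  Varunif W <= (fine (Lpnorm p x)) ^+ 2
               * powR (fine (leb (\bigcup_(K in [set K : 'I_(2 ^ N) | K \in B])
                                     dyad (N, nat_of_ord K)))) q^-1
               * powR 2 (- (N%:R) / q).
Proof.
move=> q W; case: hx => mx xp _.
have p0 : 0 < p by lra.
have q0 : 0 < q by rewrite divr_gt0// subr_gt0.
(* The exponents come in this order because the Haar combination, first in the pairing, is measured
   in [L_q] and [x] in [L_p]. *)
have qp : q^-1 + p^-1 = 1.
  by rewrite /q invf_div mulrBl divff ?gt_eqF// mul1r subrK.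
pose hK (K : 'I_(2 ^ N)) := h M (N, nat_of_ord K).
pose g (a : 'I_(2 ^ N) -> R) t := \sum_K a K * hK K t.
have mhK K : measurable_fun I01 (hK K) by exact: measurable_level.
have mg a : measurable_fun I01 (g a).
  by apply: measurable_sum => K; exact: measurable_funM.
have gE a : Lpnorm q (g a) = (((\sum_K `|a K| `^ q) * 2 ^- N) `^ q^-1)%:E.
  exact: Lpnorm_level.
(* Kronecker coefficients make a single function a special case of [g], so [gE] also gives its
   norm. *)
have hKE K : hK K = g (fun L => (L == K)%:R).
  apply/funext => t; rewrite /g (bigD1 K)//= eqxx mul1r big1 ?addr0// => L LK.
  by rewrite (negbTE LK) mul0r.
have hKq K : (Lpnorm q (hK K) < +oo)%E by rewrite hKE gE ltry.
have ihx K : leb.-integrable I01 (EFin \o (fun t => hK K t * x t)).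
  exact: (integrable_pairing (mhK K) mx q0 p0 qp (hKq K) xp).
pose c K := pairing (hK K) x.
have WE : W = fun theta => \sum_K sgn (theta K) * c (val K).
  by apply/funext => theta; exact: (pairing_sum _ (fun K => ihx (val K))).
rewrite WE Eunif_rademacher Varunif_rademacher; split => //.
set X := fine (Lpnorm p x).
have X0 : 0 <= X by rewrite fine_ge0// poweR_ge0.
have g_le a : `|pairing (g a) x| <= ((\sum_K `|a K| `^ q) * 2 ^- N) `^ q^-1 * X.
  have := pairing_le (mg a) mx q0 p0 qp; rewrite gE; apply => //; exact: ltry.
have c_le K : `|c K| <= 2 `^ (- N%:R / q) * X.
  have := g_le (fun L => (L == K)%:R); rewrite -hKE => /le_trans; apply.
  rewrite (bigD1 K)//= eqxx normr1 powR1 big1 ?addr0 => [|L LK]; last first.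
    by rewrite (negbTE LK) normr0 powR0 ?gt_eqF.
  by rewrite mul1r powRrM powRN powR_mulrn.
have sum_c_le : \sum_(K in B) `|c K| <= (#|B|%:R * 2 ^- N) `^ q^-1 * X.
  (* These coefficients turn each [a K * c K] into the modulus of [c K] on [B] and into [0]
     elsewhere. *)
  pose a K := (K \in B)%:R * Num.sg (c K).
  have -> : \sum_(K in B) `|c K| = pairing (g a) x.
    rewrite (pairing_sum a ihx) big_mkcond/=; apply: eq_bigr => K _.
    by rewrite /a; case: (K \in B); rewrite ?mul0r// mul1r normrEsg.
  apply: le_trans (ler_norm _) _; apply: le_trans (g_le a) _.
  rewrite ler_wpM2r//; apply: ge0_ler_powR.
  - by rewrite invr_ge0 ltW.
  - by rewrite nnegrE mulr_ge0 ?invr_ge0 ?exprn_ge0 ?sumr_ge0// => K _; exact: powR_ge0.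
  - by rewrite nnegrE mulr_ge0 ?invr_ge0 ?exprn_ge0.
  (* Only an inequality with the cardinal of [B] holds: [Num.sg] is [0] where [c K = 0]. *)
  rewrite ler_pM2r ?invr_gt0 ?exprn_gt0// -sum1_card natr_sum [leRHS]big_mkcond/=.
  apply: ler_sum => K _; rewrite /a; case: (K \in B).
    rewrite mul1r normr_sg; case: (c K != 0); rewrite ?powR1// powR0 ?gt_eqF//.
  by rewrite mul0r normr0 powR0 ?gt_eqF.
(* The measure of the union becomes the base [#|B|%:R * 2 ^- N] of the power in [sum_c_le]. *)
rewrite leb_bigcup_dyad/=.
have -> : \sum_(K : {K | K \in B}) c (val K) ^+ 2 = \sum_(K in B) `|c K| ^+ 2.
  by rewrite [RHS]big_sub; apply: eq_bigr => K _; rewrite real_normK ?num_real.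
(* In each square one factor is bounded uniformly by [c_le]; the other is kept for [sum_c_le]. *)
apply: (@le_trans _ _ (\sum_(K in B) `|c K| * (2 `^ (- N%:R / q) * X))).
  by apply: ler_sum => K _; rewrite expr2 ler_wpM2l.
rewrite -mulr_suml; apply: le_trans (ler_wpM2r _ sum_c_le) _.
  by rewrite mulr_ge0 ?powR_ge0.
by rewrite le_eqVlt; apply/orP; left; apply/eqP; ring.
Qed.
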